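(* Let $q$ be a prime power, let $n\ge 2$, let $p\in\mathbb{P}^2(\overline{\mathbb{F}}_q)$ be a $q^n$-point, and let the line $\ell=\langle p,f(p)\rangle$ be a $q^k$-line. Then either $k=1$ or $k=n$. Moreover, $k=n$ precisely when $p$ does not lie on any $q$-line.
   Context: $f=\mathrm{Frob}_q$ acts on $\mathbb{P}^2(\overline{\mathbb{F}}_q)$ by raising coordinates to the $q$th power, and correspondingly on lines. A point (respectively line) whose $f$-orbit has exactly $n$ elements is called a $q^n$-point (respectively $q^n$-line); a $q$-line is a $q^1$-line, i.e. a line fixed by $f$. For distinct points $p_1,p_2$, $\langle p_1,p_2\rangle$ is the unique line containing both. *)

(* Defs.v *)
From HB Require Import structures.
From mathcomp Require Import all_boot all_order all_algebra all_fingroup.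
From mathcomp Require Import all_solvable all_field.
Set Implicit Arguments.
Unset Strict Implicit.
Unset Printing Implicit Defensive.
Import GRing.Theory.
Local Open Scope ring_scope.

(* The points of P^2 over K are the lines of K^3 through the origin, and the
   lines of P^2 are the planes of K^3. *)
Definition subspace (K : fieldType) (d : nat) : Type :=
  {U : {vspace 'rV[K]_3} | \dim U == d}.

Notation point K := (subspace K 1).
Notation line K := (subspace K 2).

Definition on (K : fieldType) (p : point K) (l : line K) : bool :=
  (val p <= val l)%VS.

Lemma dim_join (K : fieldType) (p1 p2 : point K) :
  p1 != p2 -> \dim (val p1 + val p2)%VS == 2%N.
Proof.
case: p1 p2 => [U dU] [V dV] /= neUV.
have {}neUV : U != V by apply: contra neUV => /eqP eUV; apply/eqP/val_inj.
have := dimv_sum_cap U V; rewrite (eqP dU) (eqP dV).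
have : (\dim (U :&: V) < 1)%N.
  rewrite ltnNge; apply: contra neUV => cap1.
  have /eqP eU : (U :&: V)%VS == U by rewrite eqEdim capvSl (eqP dU).
  have /eqP eV : (U :&: V)%VS == V by rewrite eqEdim capvSr (eqP dV).
  by rewrite -[X in X == _]eU eV.
by case: (\dim (U :&: V)) => // _; rewrite addn0 => ->.
Qed.

Definition join (K : fieldType) (p1 p2 : point K) (ne : p1 != p2) : line K :=
  exist _ (val p1 + val p2)%VS (dim_join ne).

Lemma joinP (K : fieldType) (p1 p2 : point K) (ne : p1 != p2) (l : line K) :
  on p1 l && on p2 l = (l == join ne).
Proof.
rewrite /on -subv_add; apply/idP/eqP => [sub | -> //].
apply/val_inj/eqP; rewrite eq_sym eqEdim sub /=.
by case: l sub => V dV _; rewrite (eqP dV) (eqP (dim_join ne)).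
Qed.

Definition frobv (Fq : finFieldType) (K : closedFieldType) (v : 'rV[K]_3) :
    'rV[K]_3 :=
  map_mx (fun x => x ^+ #|Fq|) v.

(* The image of U under frobv, see frob_vsP; frobv is only semilinear, so this
   is not an instance of the library's image of a subspace. *)
Definition frob_vs (Fq : finFieldType) (K : closedFieldType)
    (U : {vspace 'rV[K]_3}) : {vspace 'rV[K]_3} :=
  <<[seq frobv Fq v | v <- vbasis U]>>%VS.

Section FrobTheory.
Variables (Fq : finFieldType) (K : closedFieldType) (iota : {rmorphism Fq -> K}).

Lemma pnat_card : [pchar K].-nat #|Fq|.
Proof.
have [p p_pr pF] := finPcharP Fq.
have pK : p \in [pchar K] by rewrite (fmorph_pchar iota).
rewrite (eq_pnat _ (pcharf_eq pK)).
have := abelem_pgroup (fin_ring_pchar_abelem pF).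
by rewrite /pgroup cardsT.
Qed.

Lemma frobvD : {morph @frobv Fq K : u v / u + v}.
Proof.
by move=> u v; apply/matrixP => i j; rewrite !mxE exprDn_pchar ?pnat_card.
Qed.

Lemma frobvZ (a : K) v : frobv Fq (a *: v) = a ^+ #|Fq| *: frobv Fq v.
Proof. by apply/matrixP => i j; rewrite !mxE exprMn. Qed.

Lemma card_gt0 : (0 < #|Fq|)%N.
Proof. by apply/card_gt0P; exists 0. Qed.

Lemma frobv0 : frobv Fq (0 : 'rV[K]_3) = 0.
Proof. by rewrite -(scale0r 0) frobvZ expr0n gtn_eqF ?card_gt0 ?scale0r. Qed.

Lemma frobv_inj : injective (@frobv Fq K).
Proof.
have ker u : frobv Fq u = 0 -> u = 0 :> 'rV[K]_3.
  move=> /matrixP e; apply/matrixP => i j; have /eqP := e i j.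
  by rewrite !mxE expf_eq0 => /andP[_ /eqP].
move=> u v e; apply/eqP; rewrite -subr_eq0; apply/eqP/ker.
by apply: (addIr (frobv Fq v)); rewrite -frobvD subrK add0r.
Qed.

Lemma frobv_sum (I : Type) (r : seq I) (F : I -> 'rV[K]_3) :
  frobv Fq (\sum_(i <- r) F i) = \sum_(i <- r) frobv Fq (F i).
Proof. exact: (big_morph _ frobvD frobv0). Qed.

Lemma frob_root (a : K) : {b | b ^+ #|Fq| = a}.
Proof.
have sz : size ('X^#|Fq| - a%:P) != 1%N.
  by rewrite size_XnsubC ?card_gt0 // eqSS gtn_eqF ?card_gt0.
case/closed_rootP/sig_eqW: sz => b; rewrite rootE !hornerE subr_eq0 => /eqP.
by exists b.
Qed.

Lemma frobv_comb n (X : n.-tuple 'rV[K]_3) (k : 'I_n -> K) :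
  \sum_i k i *: (map_tuple (@frobv Fq K) X)`_i
    = frobv Fq (\sum_i sval (frob_root (k i)) *: X`_i).
Proof.
rewrite frobv_sum; apply: eq_bigr => i _.
rewrite frobvZ (svalP (frob_root (k i))).
by rewrite (nth_map 0) ?size_tuple.
Qed.

Lemma frob_vsP (U : {vspace 'rV[K]_3}) w :
  reflect (exists2 v, v \in U & w = frobv Fq v) (w \in frob_vs Fq U).
Proof.
apply: (iffP idP) => [|[v Uv ->]].
  move=> /(@coord_span _ _ _ (map_tuple _ (vbasis U))) ->; rewrite frobv_comb.
  eexists; last by [].
  by apply: memv_suml => i _; rewrite memvZ ?vbasis_mem ?mem_nth ?size_tuple.
rewrite (coord_vbasis Uv) frobv_sum; apply: memv_suml => i _.
rewrite frobvZ memvZ ?memv_span //.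
by apply/map_f/mem_nth; rewrite size_tuple.
Qed.

Lemma frob_vline v : frob_vs Fq <[v]> = <[frobv Fq v : 'rV[K]_3]>%VS.
Proof.
apply/vspaceP => w; apply/frob_vsP/vlineP => [[u /vlineP[a ->] ->]|[a ->]].
  by exists (a ^+ #|Fq|); rewrite frobvZ.
exists (sval (frob_root a) *: v); first by rewrite memvZ ?memv_line.
by rewrite frobvZ (svalP (frob_root a)).
Qed.

Lemma dim_frob_vs (U : {vspace 'rV[K]_3}) : \dim (frob_vs Fq U) = \dim U.
Proof.
have fr : free (map_tuple (@frobv Fq K) (vbasis U)).
  apply/freeP => k; rewrite frobv_comb => e i.
  have {}e := frobv_inj (etrans e (esym frobv0)).
  have k0 := freeP (basis_free (vbasisP U)) _ e i.
  by rewrite -(svalP (frob_root (k i))) k0 expr0n gtn_eqF ?card_gt0.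
by have := eqP fr; rewrite size_tuple.
Qed.

End FrobTheory.

Lemma frob_subproof (Fq : finFieldType) (K : closedFieldType)
    (iota : {rmorphism Fq -> K}) (d : nat) (U : subspace K d) :
  \dim (frob_vs Fq (val U)) == d.
Proof. by rewrite (dim_frob_vs iota); case: U. Qed.

(* iota is only used to know that x |-> x ^+ #|Fq| is additive on K, without
   which the dimension need not be preserved. *)
Definition frob (Fq : finFieldType) (K : closedFieldType)
    (iota : {rmorphism Fq -> K}) (d : nat) (U : subspace K d) : subspace K d :=
  exist _ (frob_vs Fq (val U)) (frob_subproof iota U).

(* Forward iterates suffice: where f is injective, a finite forward orbit is
   also the orbit under the group generated by f. *)
Definition orbit_size (T : eqType) (f : T -> T) (x : T) (n : nat) : Prop :=
  exists s : seq T,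
    [/\ uniq s, size s = n & forall y, y \in s <-> exists i, y = iter i f x].

Definition is_qpoint (Fq : finFieldType) (K : closedFieldType)
    (iota : {rmorphism Fq -> K}) (n : nat) (p : point K) : Prop :=
  orbit_size (frob iota (d := 1)) p n.

Definition is_qline (Fq : finFieldType) (K : closedFieldType)
    (iota : {rmorphism Fq -> K}) (k : nat) (l : line K) : Prop :=
  orbit_size (frob iota (d := 2)) l k.

Lemma orbit_size1 (T : eqType) (f : T -> T) (x : T) :
  orbit_size f x 1 <-> f x = x.
Proof.
split=> [[[|y [|? ?]] [_ // _ sP]]|fx].
  have /sP : exists i, x = iter i f x by exists 0%N.
  have /sP : exists i, f x = iter i f x by exists 1%N.
  by rewrite !inE => /eqP-> /eqP->.
exists [:: x]; split=> // y; rewrite inE; split=> [/eqP->|[i ->]].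
  by exists 0%N.
by elim: i => //= i /eqP->; rewrite fx.
Qed.

Lemma qpoint_neq (Fq : finFieldType) (K : closedFieldType)
    (iota : {rmorphism Fq -> K}) (n : nat) (p : point K) :
  (2 <= n)%N -> is_qpoint iota n p -> p != frob iota p.
Proof.
move=> n2 [s [us sz sP]]; apply/eqP => fp.
have: {subset s <= [:: p]}.
  by move=> y /sP[i ->]; rewrite inE; elim: i => //= i /eqP->; rewrite -fp.
by move=> /(uniq_leq_size us); rewrite sz leqNgt n2.
Qed.

(* Main.v *)
Require Import Defs.
From mathcomp Require Import all_boot all_order all_algebra all_field.
Import GRing.Theory.

Set Implicit Arguments.
Unset Strict Implicit.
Unset Printing Implicit Defensive.

(** Write x_i for f^i(x). Since p and f(p) lie on l, both p_i and p_(i+1) lie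
    on l_i. They are distinct, hence determine l_i, so p_i = p_j implies
    l_i = l_j. If l is not fixed by f, then l_i and l_(i+1) are distinct lines
    through p_(i+1), hence determine it, so l_i = l_j implies p_i = p_j. The
    orbits of p and l then have the same size. Finally, a fixed line through p
    also contains f(p), so it is l. *)

Lemma orbit_size_leq (T U : eqType) (f : T -> T) (g : U -> U) (x : T) (y : U)
    (m n : nat) :
  (forall i j, iter i g y = iter j g y -> iter i f x = iter j f x) ->
  orbit_size f x m -> orbit_size g y n -> m <= n.
Proof.
move=> gf [s [us <- sP]] [t [_ <- tP]].
have [r -> ur] : exists2 r, s = [seq iter i f x | i <- r]
                          & uniq [seq iter i g y | i <- r].
  have: forall z, z \in s -> exists i, z = iter i f x by move=> z /sP.
  elim: s {sP} us => [|z s IHs] /=; first by exists [::].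
  move=> /andP[sz us] s_iter; have [|r sE ur] := IHs us.
    by move=> w sw; apply: s_iter; rewrite inE sw orbT.
  have [i zE] := s_iter z (mem_head z s).
  exists (i :: r) => /=; first by rewrite zE sE.
  rewrite ur andbT; apply: contra sz => /mapP[j rj /gf eij].
  by rewrite zE sE eij (map_f (fun i => iter i f x)).
rewrite size_map -(size_map (fun i => iter i g y)); apply: uniq_leq_size => //.
by move=> _ /mapP[i _ ->]; apply/tP; exists i.
Qed.

Lemma orbit_size_eq (T U : eqType) (f : T -> T) (g : U -> U) (x : T) (y : U)
    (m n : nat) :
  (forall i j, iter i f x = iter j f x <-> iter i g y = iter j g y) ->
  orbit_size f x m -> orbit_size g y n -> m = n.
Proof.
move=> fg xm yn; apply/eqP; rewrite eqn_leq.
by rewrite (orbit_size_leq _ xm yn) ?(orbit_size_leq _ yn xm) // => i j /fg.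
Qed.

Lemma eq_line (K : fieldType) (p q : point K) (l m : line K) :
  p != q -> on p l -> on q l -> on p m -> on q m -> l = m.
Proof.
move=> ne pl ql pm qm.
have /eqP-> : l == join ne by rewrite -joinP pl.
by apply/esym/eqP; rewrite -joinP pm.
Qed.

Lemma eq_point (K : fieldType) (p q : point K) (l m : line K) :
  l <> m -> on p l -> on q l -> on p m -> on q m -> p = q.
Proof.
move=> lm pl ql pm qm; apply/eqP/negPn/negP => ne.
exact/lm/(eq_line ne).
Qed.

Section Frobenius.
Variables (Fq : finFieldType) (K : closedFieldType).
Variable iota : {rmorphism Fq -> K}.

Lemma frob_inj (d : nat) : injective (frob iota (d := d)).
Proof.
move=> U V /(congr1 val) /= eUV; apply/val_inj/vspaceP => v.
have mem_frob (W : {vspace 'rV[K]_3}) :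
    (v \in W) = (frobv Fq v \in frob_vs Fq W).
  apply/idP/(frob_vsP iota) => [Wv|[w Ww /(frobv_inj iota)-> //]].
  by exists v.
by rewrite !mem_frob eUV.
Qed.

Lemma frob_on (p : point K) (l : line K) :
  on p l -> on (frob iota p) (frob iota l).
Proof.
move=> /subvP pl; apply/subvP => _ /(frob_vsP iota)[v pv ->].
by apply/(frob_vsP iota); exists v => //; apply: pl.
Qed.

Lemma iter_frob_on (i : nat) (p : point K) (l : line K) :
  on p l ->
  on (iter i (frob iota (d := 1)) p) (iter i (frob iota (d := 2)) l).
Proof. by move=> pl; elim: i => //= i; apply: frob_on. Qed.

Lemma iter_frob_neq (d i : nat) (U : subspace K d) :
  frob iota U <> U ->
  iter i (frob iota (d := d)) U <> iter i.+1 (frob iota (d := d)) U.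
Proof. by move=> fU; elim: i => [/esym|i IHi /frob_inj]. Qed.

Lemma iter_frob_eq (p : point K) (l : line K) :
  frob iota p <> p -> frob iota l <> l -> on p l -> on (frob iota p) l ->
  forall i j, iter i (frob iota (d := 1)) p = iter j (frob iota (d := 1)) p <->
              iter i (frob iota (d := 2)) l = iter j (frob iota (d := 2)) l.
Proof.
move=> fp fl pl fpl.
have on0 i := iter_frob_on i pl.
have on1 i := iter_frob_on i fpl.
move=> i j; split=> eij.
  have /eqP ne := iter_frob_neq (i := i) fp.
  apply: (eq_line ne); rewrite ?on0 //.
  - by rewrite iterSr on1.
  - by rewrite eij on0.
  - by rewrite iterS eij -iterS iterSr on1.
apply: frob_inj; rewrite -!iterS.
apply: (eq_point (iter_frob_neq (i := i) fl)); rewrite ?on0 //.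
- by rewrite iterSr on1.
- by rewrite eij iterSr on1.
- by rewrite [X in on _ X]iterS eij -iterS on0.
Qed.

End Frobenius.

Theorem corollary4p4 (Fq : finFieldType) (K : closedFieldType)
    (iota : {rmorphism Fq -> K})
    (K_algebraic : forall x : K, algebraicOver iota x)
    (n : nat) (n_ge2 : 2 <= n)
    (p : point K) (p_qn : is_qpoint iota n p)
    (k : nat) (l_qk : is_qline iota k (join (qpoint_neq n_ge2 p_qn))) :
  (k = 1 \/ k = n) /\
  (k = n <-> ~ exists m : line K, is_qline iota 1 m /\ on p m).
Proof.
set ne := qpoint_neq n_ge2 p_qn in l_qk *.
set l := join ne in l_qk *.
have /andP[pl fpl] : on p l && on (frob iota p) l by rewrite (joinP ne).
have fp : frob iota p <> p by move/esym/eqP; apply/negP.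
have n1 : n <> 1 by move=> n1; move: (n_ge2); rewrite n1.
have fixed_k : frob iota l = l -> k = 1.
  by move/orbit_size1; apply: (orbit_size_eq (fun i j => iff_refl _) l_qk).
have k1n : k = 1 \/ k = n.
  have [/fixed_k|/eqP fl] := eqVneq (frob iota l) l; first by left.
  right; apply/esym.
  exact: orbit_size_eq (iter_frob_eq fp fl pl fpl) p_qn l_qk.
split=> //; split=> [kn [m [/orbit_size1 fm pm]]|no_m].
  apply/n1; rewrite -kn; apply: fixed_k.
  suff -> : l = m by [].
  by apply: (eq_line ne) => //; rewrite -fm frob_on.
case: k1n => // k1; case: no_m; exists l; split=> //.
by rewrite -k1.
Qed.
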